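(* Let $\Bbbk$ be a field of characteristic zero, and let $\mathfrak{M}$ be the variety of all non-associative $\Bbbk$-algebras satisfying the identity $x(x^2)^2=(x^2)^2x$. For every free $\mathfrak{M}$-algebra $A$, its universal multiplicative enveloping algebra $U_{\mathfrak{M}}(A)$ is a free associative algebra.
   Context: A non-associative $\Bbbk$-algebra is a $\Bbbk$-vector space with a bilinear product, not assumed associative or unital; $x^2:=xx$. The free $\mathfrak{M}$-algebra on a set $Z$ is the quotient of the free non-unital non-associative algebra on $Z$ by the ideal of consequences of the identity. Universal multiplicative enveloping algebra. For an $\mathfrak{M}$-algebra $A$, an $A$-bimodule (in $\mathfrak{M}$) is a vector space $V$ with bilinear maps $A\times V\to V$ and $V\times A\to V$ such that the split null extension $A\oplus V$, with product $(a+v)(b+w)=ab+(aw+vb)$ (so that $V\cdot V=0$), belongs to $\mathfrak{M}$. The universal multiplicative enveloping algebra $U_{\mathfrak{M}}(A)$ is the unital associative algebra generated by symbols $l_a,r_a$ ($a\in A$), linear in $a$, subject to exactly those relations which must hold for the operators $l_a\colon v\mapsto av$, $r_a\colon v\mapsto va$ in all $A$-bimodules; thus left $U_{\mathfrak{M}}(A)$-modules are the same as $A$-bimodules. A (unital) associative algebra is free if it is isomorphic to the algebra $\Bbbk\langle X\rangle$ of non-commutative polynomials on some set $X$. *)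

(* Defs.v *)
From HB Require Import structures.
From mathcomp Require Import all_boot all_algebra.
From mathcomp.finmap Require Import finmap.
From mathcomp.multinomials Require Import monalg.

Set Implicit Arguments.
Unset Strict Implicit.
Unset Printing Implicit Defensive.

Import GRing.Theory.
Local Open Scope ring_scope.

(* A non-associative k-algebra is an lmodType together with a product
   mul : {bilinear A -> A -> A}. *)

Section Variety.
Variables (k : fieldType) (A : lmodType k).

Definition sq (mul : A -> A -> A) (x : A) : A := mul x x.

Definition in_M (mul : {bilinear A -> A -> A}) : Prop :=
  forall x : A, mul x (sq mul (sq mul x)) = mul (sq mul (sq mul x)) x.

Definition na_ideal (mul : A -> A -> A) (I : A -> Prop) : Prop :=
  [/\ I 0,
      forall (c : k) x y, I x -> I y -> I (c *: x + y),
      forall a x, I x -> I (mul a x)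
    & forall a x, I x -> I (mul x a)].

(* The ideal of consequences of the identity: the smallest ideal containing
   the values of x(x^2)^2 - (x^2)^2x at all elements. *)
Definition ideal_of_consequences (mul : A -> A -> A) (p : A) : Prop :=
  forall I : A -> Prop, na_ideal mul I ->
    (forall x, I (mul x (sq mul (sq mul x)) - mul (sq mul (sq mul x)) x)) ->
    I p.

End Variety.

Inductive magma (Z : Type) : Type :=
  | MGen of Z
  | MMul of magma Z & magma Z.

Section MagmaChoice.
Variable Z : Type.

Fixpoint magma_encode (m : magma Z) : GenTree.tree Z :=
  match m with
  | MGen z => GenTree.Leaf z
  | MMul m1 m2 => GenTree.Node 0 [:: magma_encode m1; magma_encode m2]
  end.

Fixpoint magma_decode (t : GenTree.tree Z) : option (magma Z) :=
  match t with
  | GenTree.Leaf z => Some (MGen z)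
  | GenTree.Node 0 [:: t1; t2] =>
      if magma_decode t1 is Some m1 then
        if magma_decode t2 is Some m2 then Some (MMul m1 m2) else None
      else None
  | _ => None
  end.

Lemma magma_encodeK : pcancel magma_encode magma_decode.
Proof. by elim=> //= m1 -> m2 ->. Qed.

End MagmaChoice.

HB.instance Definition _ (Z : choiceType) :=
  Choice.copy (magma Z) (pcan_type (@magma_encodeK Z)).

(* The free non-unital non-associative algebra on Z is {malg k[magma Z]} with
   the product extending MMul bilinearly. *)
Section FreeNonAssociative.
Variables (k : fieldType) (Z : choiceType).

Definition free_na_mul (p q : {malg k[magma Z]}) : {malg k[magma Z]} :=
  \sum_(m <- msupp p) \sum_(n <- msupp q) << p@_m * q@_n *g MMul m n >>.

Lemma malg_sum_linear (K : choiceType) (V : lmodType k) (h : K -> V) :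
  linear (fun p : {malg k[K]} => \sum_(m <- msupp p) p@_m *: h m).
Proof.
move=> c p q.
have ext (d : {fset K}) (r : {malg k[K]}) : (msupp r `<=` d)%fset ->
  \sum_(m <- msupp r) r@_m *: h m = \sum_(m <- d) r@_m *: h m.
  move=> led; apply: big_fset_incl => // m _ /mcoeff_outdom ->.
  by rewrite scale0r.
pose d := (msupp (c *: p + q) `|` msupp p `|` msupp q)%fset.
have [le1 le2 le3] : [/\ msupp (c *: p + q) `<=` d, msupp p `<=` d
    & msupp q `<=` d]%fset.
  by split; apply/fsubsetP => m; rewrite !in_fsetU => ->; rewrite ?orbT.
rewrite (ext d _ le1) (ext d _ le2) (ext d _ le3).
rewrite scaler_sumr -big_split /=; apply: eq_bigr => m _.
by rewrite mcoeffD mcoeffZ scalerDl scalerA.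
Qed.

Lemma free_na_mulE p q :
  free_na_mul p q = \sum_(m <- msupp p) p@_m *:
                      \sum_(n <- msupp q) q@_n *: << MMul m n >>.
Proof.
rewrite /free_na_mul; apply: eq_bigr => m _.
rewrite scaler_sumr; apply: eq_bigr => n _.
by apply/malgP => t; rewrite !mcoeffZ !mcoeffU mulrA mulrnAr mulr1.
Qed.

Lemma free_na_mul_bilinear : bilinear_for *:%R *:%R free_na_mul.
Proof.
split=> [q c p p' | p c q q'] /=.
  by rewrite !free_na_mulE malg_sum_linear.
rewrite !free_na_mulE scaler_sumr -big_split /=; apply: eq_bigr => m _.
by rewrite malg_sum_linear scalerDr !scalerA mulrC.
Qed.

HB.instance Definition _ := bilinear_isBilinear.Build k
  {malg k[magma Z]} {malg k[magma Z]} {malg k[magma Z]} *:%R *:%R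
  free_na_mul free_na_mul_bilinear.

(* (A, mul) is the quotient of the free non-associative algebra on Z by the
   ideal of consequences of the identity, up to isomorphism. *)
Definition free_M_algebra (A : lmodType k) (mul : {bilinear A -> A -> A}) :
    Prop :=
  exists pi : {linear {malg k[magma Z]} -> A},
    [/\ forall p q, pi (free_na_mul p q) = mul (pi p) (pi q),
        forall a, exists p, pi p = a
      & forall p, pi p = 0 <-> ideal_of_consequences free_na_mul p].

End FreeNonAssociative.

Section Bimodules.
Variables (k : fieldType) (A : lmodType k) (mul : {bilinear A -> A -> A}).

Section SplitNull.
Variables (V : lmodType k).
Variables (lact : {bilinear A -> V -> V}) (ract : {bilinear V -> A -> V}).

Definition split_null_mul (x y : A * V) : A * V :=
  (mul x.1 y.1, lact x.1 y.2 + ract x.2 y.1).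

Lemma split_null_mul_bilinear : bilinear_for *:%R *:%R split_null_mul.
Proof.
split=> [y c x x' | x c y y'] /=; congr pair => /=.
- by rewrite linearPl.
- by rewrite !linearPl /= scalerDr addrACA.
- by rewrite linearPr.
- by rewrite !linearPr /= scalerDr addrACA.
Qed.

HB.instance Definition _ := bilinear_isBilinear.Build k
  (A * V)%type (A * V)%type (A * V)%type *:%R *:%R
  split_null_mul split_null_mul_bilinear.

Definition is_bimodule : Prop := in_M split_null_mul.

(* The symbols are l_a = inl a and r_a = inr a. *)
Definition sym_act (s : A + A) (v : V) : V :=
  match s with inl a => lact a v | inr a => ract v a end.

(* A word s_1...s_n acts as the composite of the s_i, so s_n is applied
   first: U-modules are left modules. *)
Definition word_act (w : {fmonom (A + A)%type}) (v : V) : V :=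
  foldr sym_act v w.

Definition poly_act (p : {malg k[{fmonom (A + A)%type}]}) (v : V) : V :=
  \sum_(w <- msupp p) p@_w *: word_act w v.

End SplitNull.

Definition holds_in_all_bimodules (p : {malg k[{fmonom (A + A)%type}]}) :
    Prop :=
  forall (V : lmodType k)
    (lact : {bilinear A -> V -> V}) (ract : {bilinear V -> A -> V}),
    is_bimodule lact ract -> forall v : V, poly_act lact ract p v = 0.

(* U is presented by the generators l_a, r_a and the relations valid in all
   bimodules; linearity of l_a and r_a in a is among these relations. *)
Definition univ_mult_env (U : algType k) : Prop :=
  exists pi : {lrmorphism {malg k[{fmonom (A + A)%type}]} -> U},
    (forall u, exists p, pi p = u) /\
    (forall p, pi p = 0 <-> holds_in_all_bimodules p).

End Bimodules.

(* {malg k[{fmonom X}]} is the algebra of non-commutative polynomials on X. *)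
Definition free_assoc_algebra (k : fieldType) (U : algType k) : Prop :=
  exists (X : choiceType) (f : {lrmorphism {malg k[{fmonom X}]} -> U}),
    bijective f.

(* Main.v *)
(* Put s = l + r and d = l - r.  An A-bimodule is a pair of linear maps s, d
   from A into operators with d((a^2)^2) = d(a) s(a^2) s(a).  Let Q be the span
   of the elements (a^2)^2.  On the tree (xy)(zw) of the free non-associative
   algebra let cut be the average of d(x) s(zw) s(y) over the 8 symmetries of
   the tree, and let it vanish on the other trees.  Then
   cut((a^2)^2) = d(a) s(a^2) s(a), and cut kills the ideal of consequences, so
   e = d - cut is a linear map on A that vanishes on Q; conversely d is recovered
   from s and an arbitrary linear map e on A/Q by recursion on trees.  Hence U is
   free on a basis of A (the images under s) together with a basis of A/Q (the
   images under e). *)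
Require Import Defs.
From HB Require Import structures.
From mathcomp Require Import all_boot all_algebra.
From mathcomp.finmap Require Import finmap.
From mathcomp.multinomials Require Import monalg.
From mathcomp.classical Require Import boolp classical_sets.

Set Implicit Arguments.
Unset Strict Implicit.
Unset Printing Implicit Defensive.

Import GRing.Theory.
Local Open Scope ring_scope.

(** * Linear extension from monomials, and non-commutative polynomials as an algebra *)

Section LinearExtension.
Variables (k : fieldType) (K : choiceType) (V : lmodType k).

Lemma malg_linear_ext (f g : {malg k[K]} -> V) : linear f -> linear g ->
  (forall m, f << m >> = g << m >>) -> f =1 g.
Proof.
move=> lf lg fg p.
pose f' : {linear {malg k[K]} -> V} := HB.pack f (GRing.isLinear.Build _ _ _ _ f lf).
pose g' : {linear {malg k[K]} -> V} := HB.pack g (GRing.isLinear.Build _ _ _ _ g lg).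
rewrite -[f]/(f' : _ -> _) -[g]/(g' : _ -> _) (monalgE p) !linear_sum.
apply: eq_bigr => m _.
have -> : << p@_m *g m >> = p@_m *: << m >> :> {malg k[K]}.
  by apply/malgP => t; rewrite mcoeffZ !mcoeffU mulrnAr mulr1.
by rewrite !linearZ /= fg.
Qed.

Definition malg_lext (h : K -> V) (p : {malg k[K]}) : V :=
  \sum_(m <- msupp p) p@_m *: h m.

HB.instance Definition _ h := GRing.isLinear.Build k {malg k[K]} V *:%R
  (malg_lext h) (malg_sum_linear h).

Lemma malg_lextU h m : malg_lext h << m >> = h m.
Proof.
rewrite /malg_lext (big_fset_incl _ msuppU_le) ?big_seq_fset1 ?mcoeffUU ?scale1r //.
by move=> x _ /mcoeff_outdom ->; rewrite scale0r.
Qed.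

End LinearExtension.

(** Constants are central even when monomials do not commute: they sit on the unit monomial, and [k]
    is commutative. *)
Lemma malg_scalerAr (k : fieldType) (K : monomType) (c : k) (p q : {malg k[K]}) :
  c *: (p * q) = p * (c *: q).
Proof.
have malgCC (r : {malg k[K]}) : c%:MP * r = r * c%:MP.
  rewrite [LHS]malgM_def [RHS]malgM_def fgmulUg fgmulgU; apply: eq_bigr => m _.
  by rewrite mul1m mulm1 mulrC.
by rewrite -!mul_malgC mulrA malgCC mulrA.
Qed.

(* monalg makes {malg k[K]} an algType only for commutative monomials K, and
   that instance blocks another one; hence this alias. *)
Definition ncpoly (k : fieldType) (X : choiceType) : Type :=
  {malg k[{fmonom X}]}.

HB.instance Definition _ (k : fieldType) (X : choiceType) :=
  GRing.Lalgebra.on (ncpoly k X).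
HB.instance Definition _ (k : fieldType) (X : choiceType) :=
  GRing.Lalgebra_isAlgebra.Build k (ncpoly k X) (@malg_scalerAr k _).

(** * Universal property of the free associative algebra *)

Section FreeExtension.
Variables (k : fieldType) (X : choiceType).
Local Notation T := (ncpoly k X).

Definition ncvar (x : X) : T := << fmu x >>.

Lemma ncpoly_mulU (m n : {fmonom X}) :
  (<< m >> : T) * << n >> = << mmul m n >> :> T.
Proof. by rewrite [LHS]fgmulUU mulr1. Qed.

Lemma ncpoly_cons x (m : seq X) :
  << FMonom (x :: m) >> = ncvar x * << FMonom m >> :> T.
Proof. by rewrite ncpoly_mulU /mmul /= fmmulE fmuE. Qed.

Lemma ncpoly_nil : << FMonom [::] >> = 1 :> T.
Proof. by rewrite -fmoneE. Qed.

Lemma ncpoly_morphism_ext (B : lalgType k) (f g : T -> B) :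
  linear f -> monoid_morphism f -> linear g -> monoid_morphism g ->
  (forall x, f (ncvar x) = g (ncvar x)) -> f =1 g.
Proof.
move=> lf [f1 fM] lg [g1 gM] fg; apply: malg_linear_ext => //.
case; elim=> [|x m IH]; first by rewrite ncpoly_nil f1 g1.
by rewrite ncpoly_cons fM gM fg IH.
Qed.

Variables (B : algType k).

Definition nclift (h : X -> B) : T -> B :=
  malg_lext (fun m : {fmonom X} => \prod_(x <- (m : seq X)) h x).

HB.instance Definition _ h := GRing.isLinear.Build k T B *:%R (nclift h)
  (malg_sum_linear _).

Lemma ncliftU h (m : {fmonom X}) :
  nclift h << m >> = \prod_(x <- (m : seq X)) h x.
Proof. exact: malg_lextU. Qed.

Lemma nclift_monoid_morphism h : monoid_morphism (nclift h).
Proof.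
split; first by rewrite -ncpoly_nil ncliftU big_nil.
move=> p q; move: p; apply: malg_linear_ext => [c p p'|c p p'|m].
- by rewrite -linearP scalerAl -mulrDl.
- by rewrite linearP mulrDl -scalerAl.
move: q; apply: malg_linear_ext => [c p p'|c p p'|n].
- by rewrite -linearP scalerAr -mulrDr.
- by rewrite linearP mulrDr -scalerAr.
by rewrite ncpoly_mulU !ncliftU fmM big_cat.
Qed.

HB.instance Definition _ h :=
  GRing.isMonoidMorphism.Build T B (nclift h) (nclift_monoid_morphism h).

Lemma nclift_var h x : nclift h (ncvar x) = h x.
Proof. by rewrite ncliftU fmU big_seq1. Qed.

End FreeExtension.

(* Locked because conversion checks that unfold free_na_mul are intractable. *)
HB.lock Definition na_mul (k : fieldType) (Z : choiceType)
    (x y : {malg k[magma Z]}) : {malg k[magma Z]} := free_na_mul x y.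

(** * The product of the free non-associative algebra and its symmetrization *)

Section FreeProduct.
Variables (k : fieldType) (Z : choiceType).
Local Notation F := {malg k[magma Z]}.

Lemma na_mulE : @na_mul k Z = @free_na_mul k Z.
Proof. by rewrite unlock. Qed.

Lemma na_mul_bilinear : bilinear_for *:%R *:%R (@na_mul k Z).
Proof. rewrite na_mulE; exact: free_na_mul_bilinear. Qed.

HB.instance Definition _ := bilinear_isBilinear.Build k F F F *:%R *:%R
  (@na_mul k Z) na_mul_bilinear.

Lemma na_mulU (m n : magma Z) : na_mul << m >> << n >> = << MMul m n >> :> F.
Proof.
rewrite na_mulE free_na_mulE.
pose row m' := malg_lext (fun n' => << MMul m' n' >> : F) << n >>.
by rewrite -/(malg_lext row << m >>) malg_lextU /row malg_lextU.
Qed.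

Lemma ideal_of_consequences_ideal :
  na_ideal (@na_mul k Z) (ideal_of_consequences (@na_mul k Z)).
Proof.
split=> [I [] //|c x y Ix Iy I HI R|a x Ix I HI R|a x Ix I HI R].
- by case: (HI) => _ + _ _; apply; [apply: Ix|apply: Iy].
- by case: (HI) => _ _ + _; apply; apply: Ix.
- by case: (HI) => _ _ _; apply; apply: Ix.
Qed.

Definition jordan (x y : F) : F := na_mul x y + na_mul y x.

Lemma jordanC x y : jordan x y = jordan y x.
Proof. by rewrite /jordan addrC. Qed.

Lemma jordan_linear y : linear (fun x => jordan x y).
Proof.
move=> c x x'; rewrite /jordan.
have -> : na_mul (c *: x + x') y = c *: na_mul x y + na_mul x' y.
  exact: linearPl.
have -> : na_mul y (c *: x + x') = c *: na_mul y x + na_mul y x'.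
  exact: linearPr.
by rewrite scalerDr; exact: addrACA.
Qed.

End FreeProduct.

(** * The map [cut], and the recovery of d from e = d - cut *)

Section CutMap.
Variables (k : fieldType) (Z : choiceType) (B : algType k).
Local Notation F := {malg k[magma Z]}.
Local Notation "x ** y" := (@na_mul k Z x y) (at level 40).
Local Notation ideal := (ideal_of_consequences (@na_mul k Z)).

Section Fixed.
Variables (D S : {linear F -> B}).

(** Four terms stand for the eight symmetries: [jordan] already sums over the two orders of the
    factors under the first S. *)
Definition cut4 (x y z w : F) : B :=
  8%:R^-1 *: (D x * S (jordan z w) * S y + D y * S (jordan z w) * S x
            + (D z * S (jordan x y) * S w + D w * S (jordan x y) * S z)).

Definition cut_tree (m : magma Z) : B :=
  match m with
  | MMul (MMul x y) (MMul z w) => cut4 << x >> << y >> << z >> << w >>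
  | _ => 0
  end.

Definition cut : F -> B := malg_lext cut_tree.

HB.instance Definition _ := GRing.Linear.on cut.

Lemma cutU m : cut << m >> = cut_tree m.
Proof. exact: malg_lextU. Qed.

Lemma cut4C x y z w : cut4 x y z w = cut4 z w x y.
Proof. by rewrite /cut4 addrC. Qed.

Lemma cut4Cl x y z w : cut4 x y z w = cut4 y x z w.
Proof. by rewrite /cut4 (jordanC y x) (addrC (D x * _ * _)). Qed.

Lemma cut4Cr x y z w : cut4 x y z w = cut4 x y w z.
Proof. by rewrite cut4C cut4Cl cut4C. Qed.

(** One argument suffices, since the symmetries of [cut4] carry linearity to the other three. *)
Lemma cut4_linear y z w : linear (fun x => cut4 x y z w).
Proof.
move=> c x x'; rewrite /cut4.
have outer1 u v : D (c *: x + x') * u * v = c *: (D x * u * v) + D x' * u * v.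
  by rewrite linearP !mulrDl -!scalerAl.
have outer2 u : u * S (c *: x + x') = c *: (u * S x) + u * S x'.
  by rewrite linearP mulrDr -scalerAr.
have inner u v : u * S (jordan (c *: x + x') y) * v =
    c *: (u * S (jordan x y) * v) + u * S (jordan x' y) * v.
  by rewrite jordan_linear linearP mulrDr mulrDl -scalerAr -scalerAl.
have comb (a a' b b' : B) :
    c *: a + a' + (c *: b + b') = c *: (a + b) + (a' + b').
  by rewrite addrACA -scalerDr.
by rewrite outer1 outer2 !inner !comb scalerDr !scalerA mulrC.
Qed.

Lemma cutM x y z w : cut ((x ** y) ** (z ** w)) = cut4 x y z w.
Proof.
move: x; apply: malg_linear_ext => [c x x'|c x x'|x].
- by rewrite 2!linearPl linearP.
- exact: cut4_linear.
move: y; apply: malg_linear_ext => [c y y'|c y y'|y].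
- by rewrite linearPr linearPl linearP.
- by rewrite cut4Cl cut4_linear !(cut4Cl _ << x >>).
move: z; apply: malg_linear_ext => [c z z'|c z z'|z].
- by rewrite linearPl linearPr linearP.
- by rewrite cut4C cut4_linear !(cut4C _ w).
move: w; apply: malg_linear_ext => [c w w'|c w w'|w].
- by rewrite 2!linearPr linearP.
- by rewrite cut4Cr cut4C cut4_linear -!(cut4C << x >>) !(cut4Cr _ _ << z >>).
by rewrite (na_mulU k x y) (na_mulU k z w) na_mulU cutU.
Qed.

(** On trees, both sides are 0 if a factor is a generator; otherwise the swap is one of the
    symmetries averaged over. *)
Lemma cutC p q : cut (p ** q) = cut (q ** p).
Proof.
move: p; apply: malg_linear_ext => [c p p'|c p p'|p].
- by rewrite linearPl linearP.
- by rewrite linearPr linearP.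
move: q; apply: malg_linear_ext => [c q q'|c q q'|q].
- by rewrite linearPr linearP.
- by rewrite linearPl linearP.
rewrite (na_mulU k p q) cutU (na_mulU k q p) cutU.
by case: p q => [?|x y] [?|z w]; [| | | exact: cut4C].
Qed.

Lemma cut_gen (z : Z) q : cut (<< MGen z >> ** q) = 0.
Proof.
move: q; apply: malg_linear_ext => [c q q'|c q q'|q].
- by rewrite linearPr linearP.
- by rewrite scaler0 addr0.
by rewrite na_mulU cutU.
Qed.

Hypothesis char_not2 : 2%:R != 0 :> k.

(** All eight terms of the average coincide when the four subtrees are equal; [char_not2] makes 8 =
    2^3 invertible. *)
Lemma cut_sq_sq x :
  cut (sq (@na_mul k Z) (sq (@na_mul k Z) x)) = D x * S (x ** x) * S x.
Proof.
have n8 : 8%:R != 0 :> k by rewrite -[8%N]/(2 ^ 3)%N natrX expf_neq0.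
rewrite /sq cutM /cut4.
have -> : S (jordan x x) = S (x ** x) *+ 2 by rewrite /jordan linearD mulr2n.
rewrite !mulrnAr !mulrnAl -!mulr2n -!mulrnA -scaler_nat scalerA.
by rewrite mulVf // scale1r.
Qed.

Hypothesis S_ideal : forall y, ideal y -> S y = 0.
Hypothesis D_ideal : forall y, ideal y -> cut y = 0 -> D y = 0.

(** The assumption on D is conditional so that D = [uncut] is covered too: there, vanishing of D on
    the ideal is known only where [cut] vanishes. The proof uses minimality of the ideal of
    consequences. *)
Lemma cut_ideal y : ideal y -> cut y = 0.
Proof.
(* The last clause is what makes K an ideal: cut (x ** (t1 ** t2)) depends on
   t2 only through D t2, S t2 and S (t1 ** t2 + t2 ** t1). *)
pose K y := [/\ ideal y, cut y = 0 & forall x, cut (x ** y) = 0].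
have [I0 IP Il Ir] := (@ideal_of_consequences_ideal k Z).
have cut4_0 x y' z w : ideal x -> cut x = 0 -> cut4 x y' z w = 0.
  move=> Ix cx; rewrite /cut4 (D_ideal Ix cx) (S_ideal Ix).
  have -> : S (jordan x y') = 0.
    by rewrite /jordan linearD /= (S_ideal (Ir y' _ Ix)) (S_ideal (Il y' _ Ix)) addr0.
  by rewrite !(mulr0, mul0r, addr0) scaler0.
suff KI : na_ideal (@na_mul k Z) K.
  move=> Iy; suff [] : K y by [].
  (* For q = (a^2)^2, [cut] kills aq - qa by [cutC], and kills x(aq - qa) because [cut4] is
     symmetric in its last two arguments. *)
  apply: Iy => // a; split=> [I HI R //||x].
    by rewrite linearB /= cutC subrr.
  rewrite linearBr linearB /=; apply/eqP; rewrite subr_eq0; apply/eqP.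
  move: x; apply: malg_linear_ext => [c p p'|c p p'|[?|m n]].
  - by rewrite linearPl linearP.
  - by rewrite linearPl linearP.
  - by rewrite !cut_gen.
  by rewrite -na_mulU !cutM cut4Cr.
have cut0M x t1 t2 : K t2 -> cut (x ** (t1 ** t2)) = 0.
  move=> [It c2 _].
  move: x; apply: malg_linear_ext => [c p p'|c p p'|[?|m n]].
  - by rewrite linearPl linearP.
  - by rewrite scaler0 addr0.
  - by rewrite !cut_gen.
  by rewrite -na_mulU !cutM cut4Cr cut4C cut4_0.
split.
- split=> // [|x]; first exact: linear0.
  by rewrite linear0r linear0.
- move=> c x x' [Ix cx Kx] [Ix' cx' Kx']; split; first exact: IP.
    by rewrite linearP /= cx cx' scaler0 addr0.
  by move=> t; rewrite linearPr linearP /= Kx Kx' scaler0 addr0.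
- move=> a x Kx; case: (Kx) => Ix cx cKx; split=> [||t]; [exact: Il|exact: cKx|].
  exact: cut0M.
- move=> a x Kx; case: (Kx) => Ix cx cKx; split=> [||t]; [exact: Ir| |].
    by rewrite cutC.
  move: t; apply: malg_linear_ext => [c p p'|c p p'|[?|m n]].
  - by rewrite linearPl linearP.
  - by rewrite scaler0 addr0.
  - by rewrite !cut_gen.
  by rewrite -na_mulU !cutM cut4C cut4_0.
Qed.

End Fixed.

Section Recursion.
Variables (E S : {linear F -> B}).

(** Solves d = e + cut for d. The recursion is structural because [cut] at (xy)(zw) uses d only at
    x, y, z, w. The body spells out [cut4], which would need d as a linear map on all of F. *)
Fixpoint uncut_tree (m : magma Z) : B :=
  E << m >> +
  match m with
  | MMul (MMul x y) (MMul z w) =>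
    let S2 m n := S (jordan << m >> << n >>) in
    8%:R^-1 *: (uncut_tree x * S2 z w * S << y >> + uncut_tree y * S2 z w * S << x >>
              + (uncut_tree z * S2 x y * S << w >> + uncut_tree w * S2 x y * S << z >>))
  | _ => 0
  end.

Definition uncut : F -> B := malg_lext uncut_tree.

HB.instance Definition _ := GRing.Linear.on uncut.

Lemma uncutE p : uncut p = E p + cut uncut S p.
Proof.
move: p; apply: malg_linear_ext => [||m]; [exact: linearP | |].
  move=> c p q; rewrite !linearP addrACA scalerDr //.
rewrite cutU /uncut malg_lextU; case: m => // -[?|x y] [?|z w] //=.
by rewrite /cut4 /= /uncut !malg_lextU.
Qed.

End Recursion.
End CutMap.

(** * A basis of a vector space modulo a subspace, by Zorn's lemma *)

Section BasisModuloSubspace.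
Variables (k : fieldType) (V : lmodType k) (Q : V -> Prop).
Hypothesis Q0 : Q 0.
Hypothesis QP : forall (c : k) x y, Q x -> Q y -> Q (c *: x + y).

Local Notation eval := (@malg_lext k V V id).

(** Elements of [{malg k[V]}] serve as formal linear combinations of vectors; [eval] computes them
    in V. *)
Definition supported (C : set V) (p : {malg k[V]}) :=
  forall v, v \in msupp p -> C v.

(** Linear independence in V/Q, phrased without forming the quotient. *)
Definition indep_mod (C : set V) : Prop :=
  forall p : {malg k[V]}, supported C p -> Q (eval p) -> p = 0.

Lemma supportedP C c p q :
  supported C p -> supported C q -> supported C (c *: p + q).
Proof.
move=> Cp Cq v /(fsubsetP (msuppD_le _ _)); rewrite in_fsetU => /orP[|/Cq //].
by move=> /(fsubsetP (msuppZ_le _ _)) /Cp.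
Qed.

Lemma supportedU (C : set V) v : C v -> supported C << v >>.
Proof.
by move=> Cv u /(fsubsetP msuppU_le); rewrite in_fset1 => /eqP ->.
Qed.

(** A maximal independent set spans modulo Q: a vector outside its span could be adjoined. *)
Lemma maximal_indep_mod :
  exists C, indep_mod C /\ forall v, exists p, supported C p /\ Q (v - eval p).
Proof.
have [|C [indC maxC]] := @Zorn_bigcup V indep_mod.
  move=> F FP Ftot p pF Qp.
  (* A finite support inside the union of a chain lies in one member of it; the empty support is
     separate because the chain may be empty. *)
  have bounded (s : seq V) :
      (forall v, v \in s -> (\bigcup_(X in F) X)%classic v) ->
      s = [::] \/ exists2 X, F X & forall v, v \in s -> X v.
    elim: s => [|v s IH] sF; [by left|right].
    have [X FX Xv] : (\bigcup_(X in F) X)%classic v by apply: sF; rewrite in_cons eqxx.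
    case: IH => [u us|->|[Y FY sY]]; first by apply: sF; rewrite in_cons us orbT.
      by exists X => // u; rewrite mem_seq1 => /eqP ->.
    have [XY|YX] := Ftot _ _ FX FY.
      by exists Y => // u; rewrite in_cons => /orP[/eqP ->|/sY //]; apply: XY.
    by exists X => // u; rewrite in_cons => /orP[/eqP -> //|/sY]; apply: YX.
  have [p0|[X FX Xp]] := bounded (msupp p) pF; last exact: FP Xp Qp.
  apply/malgP => v; rewrite mcoeff0 mcoeff_outdom //.
  by rewrite -[_ \in _]/(v \in (msupp p : seq V)) p0.
exists C; split=> // v; apply: contrapT => nv.
have nCv : ~ C v.
  move=> Cv; apply: nv; exists << v >>; split; first exact: supportedU.
  by rewrite malg_lextU subrr.
have CCv : (C `<` C `|` [set v])%classic.
  by split=> [u|/(_ v) CC]; [left | apply: nCv; apply: CC; right].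
apply: (maxC _ CCv).
move=> p pC Qp; set c := p@_v.
pose p' := - c *: << v >> + p.
have p'C : supported C p'.
  move=> u; rewrite -mcoeff_neq0 mcoeffD mcoeffZ mcoeffU.
  have [<-|vu] := eqVneq v u; first by rewrite mulr1 addNr eqxx.
  rewrite mulr0 add0r mcoeff_neq0 => /pC [] // uv.
  by rewrite uv eqxx in vu.
have pE : p = c *: << v >> + p' by rewrite /p' scaleNr addrA subrr add0r.
have [c0|c0] := eqVneq c 0.
  have pp' : p = p' by rewrite pE c0 scale0r add0r.
  by apply: indC Qp; rewrite pp'.
(* As c v + [eval p'] lies in Q, v equals -c^-1 [eval p'] modulo Q. The summand 0 gives the shape
   that [supportedP] and [QP] expect. *)
case: nv; exists (- c^-1 *: p' + 0); split.
  by apply: supportedP => // u; rewrite msupp0.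
move: Qp; rewrite pE linearP /= malg_lextU => /(QP c^-1) => /(_ _ Q0).
by rewrite !addr0 scalerDr scalerA mulVf // scale1r linearZ /= scaleNr opprK.
Qed.

(** The coordinates of v form the unique combination supported in the maximal set that represents v
    modulo Q; uniqueness makes them linear in v and zero on Q. *)
Lemma basis_mod :
  exists (X : choiceType) (e : X -> V) (coord : {linear V -> {malg k[X]}}),
  [/\ forall x, coord (e x) = << x >>,
      forall v, Q v -> coord v = 0
    & forall v, Q (v - malg_lext e (coord v))].
Proof.
have [C [indC spanC]] := maximal_indep_mod.
have [f fP] := choice spanC.
have unique p q v : supported C p -> Q (v - eval p) ->
    supported C q -> Q (v - eval q) -> p = q.
  move=> Cp Qp Cq Qq; apply/eqP; rewrite -subr_eq0; apply/eqP.
  rewrite addrC -scaleN1r; apply: indC; first exact: supportedP.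
  have := QP (-1) Qp Qq.
  by rewrite linearP /= !scaleN1r opprB addrA subrK addrC.
have f_linear : linear f.
  move=> c u v; apply: (@unique _ _ (c *: u + v)); try exact: (fP _).1.
  - exact: (fP _).2.
  - by apply: supportedP; exact: (fP _).1.
  - have := QP c (fP u).2 (fP v).2.
    by rewrite linearP /= scalerBr opprD addrACA.
pose X := {v : V | v \in C}.
(* The default 0 is never reached on [f v], whose support lies in C. *)
pose to_X (v : V) : {malg k[X]} := if insub v is Some x then << x >> else 0.
have coord_linear : linear (malg_lext to_X \o f).
  by move=> c u v /=; rewrite f_linear linearP.
pose coord : {linear V -> {malg k[X]}} :=
  HB.pack (malg_lext to_X \o f) (GRing.isLinear.Build _ _ _ _ _ coord_linear).
exists X, (fun x : X => val x), coord; split=> [x|v Qv|v].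
- rewrite /coord /=; have -> : f (val x) = << val x >>.
    apply: (@unique _ _ (val x)); try exact: (fP _).1; try exact: (fP _).2.
      by apply: supportedU; exact: set_mem (valP x).
    by rewrite malg_lextU subrr.
  by rewrite malg_lextU /to_X valK.
- rewrite /coord /=; have -> : f v = 0; last exact: linear0.
  apply: (@unique _ _ v); try exact: (fP _).1; try exact: (fP _).2.
    by move=> u; rewrite msupp0.
  by rewrite linear0 subr0.
- have -> : malg_lext (fun x : X => val x) (coord v) = eval (f v).
    rewrite /coord /= [X in malg_lext _ X]/malg_lext linear_sum [RHS]/malg_lext.
    rewrite big_seq [RHS]big_seq; apply: eq_bigr => u /((fP v).1 u) Cu.
    rewrite linearZ /= /to_X; case: insubP => [x _ <-|].
      by rewrite malg_lextU.
    by rewrite mem_set.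
  exact: (fP v).2.
Qed.

End BasisModuloSubspace.

(** * Compatibility of [cut] and [uncut] with algebra morphisms *)

Section CutMorphism.
Variables (k : fieldType) (Z : choiceType) (B C : algType k).
Local Notation F := {malg k[magma Z]}.
Variables (g : {lrmorphism B -> C}) (D S : {linear F -> B}) (D' S' : {linear F -> C}).
Hypothesis gS : forall p, g (S p) = S' p.

(** Agreement of D and D' is asked only at the four arguments, which is all that an induction on
    trees provides. *)
Lemma cut4_morph x y z w : g (D x) = D' x -> g (D y) = D' y ->
  g (D z) = D' z -> g (D w) = D' w ->
  g (cut4 D S x y z w) = cut4 D' S' x y z w.
Proof.
by move=> gx gy gz gw; rewrite /cut4 linearZ /= !rmorphD !rmorphM /= gx gy gz gw !gS.
Qed.

Lemma cut_morph (gD : forall p, g (D p) = D' p) p : g (cut D S p) = cut D' S' p.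
Proof.
move: p; apply: malg_linear_ext => [c p q|c p q|m].
- by rewrite !linearP.
- by rewrite linearP.
rewrite !cutU; case: m => [?|[?|x y] [?|z w]]; rewrite /cut_tree ?linear0 //.
exact: cut4_morph.
Qed.

End CutMorphism.

Section UncutMorphism.
Variables (k : fieldType) (Z : choiceType) (B C : algType k).
Local Notation F := {malg k[magma Z]}.
Variables (g : {lrmorphism B -> C}) (E S : {linear F -> B}) (D' S' : {linear F -> C}).
Hypothesis gS : forall p, g (S p) = S' p.
Hypothesis gE : forall p, g (E p) = D' p - cut D' S' p.

(** Uniqueness of the solution of d = e + cut: the image of [uncut] under g obeys the same recursion
    as D'. *)
Lemma uncut_morph p : g (uncut E S p) = D' p.
Proof.
move: p; apply: malg_linear_ext => [c p q|c p q|m].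
- by rewrite !linearP.
- by rewrite linearP.
pose P m := g (uncut E S << m >>) = D' << m >>.
(* The claim is strengthened to both children because [cut] reaches the grandchildren. *)
suff [] : P m /\ if m is MMul x y then P x /\ P y else True by [].
elim: m => [z|m [Pm IHm] n [Pn IHn]]; split=> //.
  by rewrite /P uncutE linearD /= gE !cutU /cut_tree subr0 linear0 addr0.
rewrite /P uncutE linearD /= gE !cutU.
case: m n IHm IHn {Pm Pn} => [?|x y] [?|z w]; rewrite /cut_tree;
  try by rewrite subr0 linear0 addr0.
case=> Px Py [Pz Pw]; rewrite (@cut4_morph _ _ _ _ g _ _ D' S') //.
exact: subrK.
Qed.

End UncutMorphism.

(** * Action of polynomials in the symbols on a bimodule *)

Section Bimodules.
Variables (k : fieldType) (A V : lmodType k).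
Variables (lact : {bilinear A -> V -> V}) (ract : {bilinear V -> A -> V}).
Local Notation P := (ncpoly k (A + A)%type).

Lemma poly_actU w v : poly_act lact ract << w >> v = word_act lact ract w v.
Proof. exact: malg_lextU. Qed.

Lemma poly_act_linearl v : linear (fun p : P => poly_act lact ract p v).
Proof. exact: malg_sum_linear. Qed.

Lemma word_act_linear w : linear (word_act lact ract w).
Proof.
move=> c u v; rewrite /word_act; elim: (w : seq _) => //= -[] a s ->.
  exact: linearPr.
exact: linearPl.
Qed.

Lemma poly_act_linearr p : linear (poly_act lact ract p).
Proof.
move=> c u v; move: p; apply: malg_linear_ext => [||w].
- exact: poly_act_linearl.
- move=> d p q; rewrite (poly_act_linearl u) (poly_act_linearl v) !scalerDr.
  by rewrite !scalerA mulrC addrACA.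
- by rewrite !poly_actU word_act_linear.
Qed.

Lemma poly_actM (p q : P) v :
  poly_act lact ract (p * q) v = poly_act lact ract p (poly_act lact ract q v).
Proof.
move: p; apply: malg_linear_ext => [c p p'|c p p'|m].
- by rewrite mulrDl -scalerAl (poly_act_linearl v).
- exact: poly_act_linearl.
move: q; apply: malg_linear_ext => [c q q'|c q q'|n].
- by rewrite mulrDr -scalerAr (poly_act_linearl v).
- by rewrite (poly_act_linearl v) poly_act_linearr.
by rewrite ncpoly_mulU !poly_actU /word_act fmM foldr_cat.
Qed.

Lemma poly_act_var (s : A + A) v :
  poly_act lact ract (ncvar k s) v = sym_act lact ract s v.
Proof. by rewrite poly_actU /word_act fmU. Qed.

End Bimodules.

(** * An associative algebra as a bimodule over A *)

Section RegularBimodule.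
Variables (k : fieldType) (A : lmodType k) (mul : {bilinear A -> A -> A}).
Variables (T : algType k) (L R : {linear A -> T}).

(** Bimodules are left modules over the envelope, so [l_a] and [r_a] both become left
    multiplications, by [L a] and [R a]. *)
Definition regular_lact (a : A) (v : T) : T := L a * v.
Definition regular_ract (v : T) (a : A) : T := R a * v.

Lemma regular_lact_bilinear : bilinear_for *:%R *:%R regular_lact.
Proof.
split=> [v c a b|a c v w]; rewrite /regular_lact /=.
  by rewrite linearP mulrDl -scalerAl.
by rewrite mulrDr -scalerAr.
Qed.

Lemma regular_ract_bilinear : bilinear_for *:%R *:%R regular_ract.
Proof.
split=> [a c v w|v c a b]; rewrite /regular_ract /=.
  by rewrite mulrDr -scalerAr.
by rewrite linearP mulrDl -scalerAl.
Qed.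

HB.instance Definition _ := bilinear_isBilinear.Build k A T T *:%R *:%R
  regular_lact regular_lact_bilinear.
HB.instance Definition _ := bilinear_isBilinear.Build k T A T *:%R *:%R
  regular_ract regular_ract_bilinear.

(** With s = L + R, d = L - R and q = (a^2)^2, the V-component of ((a+v)^2)^2 is W = s(a^2)s(a)v.
    The identity at a+v then reads L(a)W + R(q)v = L(q)v + R(a)W, that is, d(a)W = d(q)v. *)
Lemma regular_is_bimodule : in_M mul ->
  (forall a, (L a - R a) * (L (mul a a) + R (mul a a)) * (L a + R a) =
             L (sq mul (sq mul a)) - R (sq mul (sq mul a))) ->
  is_bimodule mul regular_lact regular_ract.
Proof.
move=> AM LR [a v]; rewrite /split_null_mul /sq /=; congr pair; first exact: AM.
rewrite /split_null_mul /regular_lact /regular_ract /=.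
set W := L (mul a a) * _ + _.
have WE : W = (L (mul a a) + R (mul a a)) * ((L a + R a) * v).
  by rewrite /W !mulrDl.
set q := mul _ (mul a a).
have LRW : L a * W - R a * W = L q * v - R q * v.
  by rewrite -!mulrBl WE !mulrA LR.
change (L a * W + R q * v = L q * v + R a * W).
by rewrite -[L a * W](subrK (R a * W)) LRW addrAC subrK.
Qed.

(** Evaluating at v = 1 turns a relation valid in all bimodules into an equation in T. *)
Lemma regular_poly_act (p : ncpoly k (A + A)%type) v :
  poly_act regular_lact regular_ract p v =
  nclift (fun s => match s with inl a => L a | inr a => R a end) p * v.
Proof.
move: p; apply: malg_linear_ext => [||m]; first exact: poly_act_linearl.
  by move=> c p q; rewrite linearP mulrDl -scalerAl.
rewrite poly_actU ncliftU /word_act.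
elim: (m : seq _) => [|s t IH]; first by rewrite big_nil mul1r.
by rewrite big_cons -mulrA -IH; case: s.
Qed.

End RegularBimodule.

(** * Relations between the generators of the enveloping algebra *)

Section UniversalEnvelope.
Variables (k : fieldType) (A : lmodType k) (mul : {bilinear A -> A -> A}).
Variables (U : algType k) (rho : {lrmorphism ncpoly k (A + A)%type -> U}).
Hypothesis rhoP : forall p, rho p = 0 <-> holds_in_all_bimodules mul p.

Definition env_l (a : A) : U := rho (ncvar k (inl a)).
Definition env_r (a : A) : U := rho (ncvar k (inr a)).

Lemma env_eq p q :
  (forall (V : lmodType k) (lact : {bilinear A -> V -> V})
    (ract : {bilinear V -> A -> V}), is_bimodule mul lact ract ->
    poly_act lact ract p =1 poly_act lact ract q) -> rho p = rho q.
Proof.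
move=> pq; apply/eqP; rewrite -subr_eq0 -linearB; apply/eqP/rhoP.
move=> V lact ract bim v; rewrite addrC -scaleN1r (poly_act_linearl lact ract v).
by rewrite (pq V lact ract bim) scaleN1r addNr.
Qed.

Lemma env_l_linear : linear env_l.
Proof.
move=> c a b; rewrite /env_l -linearP; apply: env_eq => V lact ract _ v.
by rewrite (poly_act_linearl lact ract v) !poly_act_var /= linearPl.
Qed.

Lemma env_r_linear : linear env_r.
Proof.
move=> c a b; rewrite /env_r -linearP; apply: env_eq => V lact ract _ v.
by rewrite (poly_act_linearl lact ract v) !poly_act_var /= linearPr.
Qed.

(** The same component of the identity at a+v, read in an arbitrary bimodule. *)
Lemma env_relation a :
  (env_l a - env_r a) * (env_l (mul a a) + env_r (mul a a)) * (env_l a + env_r a)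
  = env_l (sq mul (sq mul a)) - env_r (sq mul (sq mul a)).
Proof.
rewrite /env_l /env_r -!linearB -!linearD -!rmorphM.
apply: env_eq => V lact ract bim v.
have actD p q u : poly_act lact ract (p + q) u =
    poly_act lact ract p u + poly_act lact ract q u.
  by have := poly_act_linearl lact ract u 1 p q; rewrite /= !scale1r.
have actB p q u : poly_act lact ract (p - q) u =
    poly_act lact ract p u - poly_act lact ract q u.
  have := poly_act_linearl lact ract u (-1) q p.
  by rewrite /= !scaleN1r ![- _ + _]addrC.
rewrite !poly_actM !(actB, actD) !poly_act_var /=.
have /(congr1 snd) := bim (a, v); rewrite /sq /= /split_null_mul /=.
set W := lact (mul a a) _ + _; set q := mul _ (mul a a) => bimW.
apply/eqP; rewrite subr_eq addrAC -bimW.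
by rewrite addrK.
Qed.

End UniversalEnvelope.

(** * The isomorphism between the free algebra and the enveloping algebra *)

Lemma linear_ex (k : fieldType) (V W : lmodType k) (f : V -> W) :
  linear f -> exists g : {linear V -> W}, g =1 f.
Proof.
move=> fP; pose g : {linear V -> W} :=
  HB.pack f (GRing.isLinear.Build _ _ _ _ _ fP).
by exists g.
Qed.

Lemma linear_factor (k : fieldType) (W V B : lmodType k) (pi : {linear W -> V})
    (G : {linear W -> B}) :
  (forall v, exists w, pi w = v) -> (forall w, pi w = 0 -> G w = 0) ->
  exists G' : {linear V -> B}, forall w, G' (pi w) = G w.
Proof.
move=> pi_surj piG.
have [s sK] := choice pi_surj.
have Geq w w' : pi w = pi w' -> G w = G w'.
  move=> ww'; apply/eqP; rewrite -subr_eq0 -linearB; apply/eqP/piG.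
  by rewrite linearB /= ww' subrr.
have Gs_linear : linear (G \o s).
  by move=> c u v /=; rewrite -linearP; apply: Geq; rewrite linearP /= !sK.
have [G' G'E] := linear_ex Gs_linear.
by exists G' => w; rewrite G'E /=; apply: Geq; rewrite sK.
Qed.

(** Two inverse morphisms are built: [chi] from U to the free algebra T, by making T a bimodule, and
    [f] from T to U, by choosing images of the variables. *)
Lemma free_envelope (k : fieldType) (Z : choiceType) (A : lmodType k)
    (mul : {bilinear A -> A -> A}) (U : algType k)
    (pi : {linear {malg k[magma Z]} -> A})
    (rho : {lrmorphism ncpoly k (A + A)%type -> U}) :
  2%:R != 0 :> k ->
  (forall p q, pi (na_mul p q) = mul (pi p) (pi q)) ->
  (forall a, exists p, pi p = a) ->
  (forall p, pi p = 0 <-> ideal_of_consequences (@na_mul k Z) p) ->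
  (forall u, exists p, rho p = u) ->
  (forall p, rho p = 0 <-> holds_in_all_bimodules mul p) ->
  exists (X : choiceType) (f : {lrmorphism ncpoly k X -> U}), bijective f.
Proof.
move=> k2 piM pi_surj piI rho_surj rhoP.
have half_sum (V : lmodType k) (x y : V) : 2%:R^-1 *: ((x + y) + (x - y)) = x.
  by rewrite addrACA subrr addr0 -mulr2n -scaler_nat scalerA mulVf ?scale1r.
have half_diff (V : lmodType k) (x y : V) : 2%:R^-1 *: ((x + y) - (x - y)) = y.
  by rewrite opprB addrC addrA subrK -mulr2n -scaler_nat scalerA mulVf ?scale1r.
have piM4 p : pi (sq (@na_mul k Z) (sq (@na_mul k Z) p)) = sq mul (sq mul (pi p)).
  by rewrite /sq !piM.
have AM : in_M mul.
  move=> a; have [p <-] := pi_surj a.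
  apply/eqP; rewrite -subr_eq0 -piM4 -!piM -linearB; apply/eqP/piI.
  by move=> I _; apply.
pose lU := env_l rho; pose rU := env_r rho.
have lUP := env_l_linear rhoP; have rUP := env_r_linear rhoP.
have [sU sUE] : exists sU : {linear A -> U}, forall a, sU a = lU a + rU a.
  apply: linear_ex => c a b.
  by rewrite /lU /rU lUP rUP scalerDr addrACA.
have [dU dUE] : exists dU : {linear A -> U}, forall a, dU a = lU a - rU a.
  apply: linear_ex => c a b.
  by rewrite /lU /rU lUP rUP opprD scalerBr addrACA.
have relU a : dU a * sU (mul a a) * sU a = dU (sq mul (sq mul a)).
  by rewrite !dUE !sUE; exact: env_relation.
pose sFU : {linear {malg k[magma Z]} -> U} := sU \o pi.
pose dFU : {linear {malg k[magma Z]} -> U} := dU \o pi.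
(* [dFU] and [sFU] factor through A, so they vanish on the ideal outright; hence d - cut descends to
   A. *)
have cutU_ideal p : pi p = 0 -> cut dFU sFU p = 0.
  move=> /piI; apply: cut_ideal => q /piI q0; last move=> _.
    by rewrite /sFU /= q0 linear0.
  by rewrite /dFU /= q0 linear0.
have [eFU eFUE] : exists eFU : {linear {malg k[magma Z]} -> U},
    forall p, eFU p = dFU p - cut dFU sFU p.
  by apply: linear_ex => c p q; rewrite !linearP addrACA -scalerDr.
have [eU eUE] : exists eU : {linear A -> U}, forall p, eU (pi p) = eFU p.
  apply: linear_factor => // p p0; rewrite eFUE (cutU_ideal _ p0) subr0.
  by rewrite /dFU /= p0 linear0.
pose Q a := forall I : A -> Prop, I 0 ->
  (forall c x y, I x -> I y -> I (c *: x + y)) ->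
  (forall x, I (sq mul (sq mul x))) -> I a.
have Q0 : Q 0 by [].
have QP c x y : Q x -> Q y -> Q (c *: x + y).
  by move=> Qx Qy I I0 IP I4; apply: (IP); [exact: Qx | exact: Qy].
(* At (x^2)^2 the value of [cut] is d(x)s(x^2)s(x), which the relation in U equates with d. *)
have eU_Q a : Q a -> eU a = 0.
  move=> /(_ (fun a => eU a = 0)); apply=> [|c x y x0 y0|x]; first exact: linear0.
    by rewrite linearP /= x0 y0 scaler0 addr0.
  have [p <-] := pi_surj x.
  rewrite -piM4 eUE eFUE (cut_sq_sq _ _ k2) /dFU /sFU /= piM4 piM.
  by rewrite relU subrr.
have zeroP (c : k) (x y : A) : x = 0 -> y = 0 -> c *: x + y = 0.
  by move=> -> ->; rewrite scaler0 addr0.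
(* A basis of A is a basis modulo the zero subspace. *)
have [X1 [e1 [c1 [c1e _ e1c]]]] :=
  basis_mod (erefl : (fun a : A => a = 0) 0) zeroP.
have [X2 [e2 [c2 [c2e c2Q e2c]]]] := basis_mod Q0 QP.
pose X : choiceType := (X1 + X2)%type.
pose T := ncpoly k X.
have [sT sTE] : exists sT : {linear A -> T},
    forall a, sT a = malg_lext (fun x => ncvar k (inl x : X)) (c1 a).
  by apply: linear_ex => c a b; rewrite !linearP.
have [eT eTE] : exists eT : {linear A -> T},
    forall a, eT a = malg_lext (fun x => ncvar k (inr x : X)) (c2 a).
  by apply: linear_ex => c a b; rewrite !linearP.
pose sFT : {linear {malg k[magma Z]} -> T} := sT \o pi.
pose eFT : {linear {malg k[magma Z]} -> T} := eT \o pi.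
have dFT_ideal p : pi p = 0 -> uncut eFT sFT p = 0.
  (* On the ideal [eFT] vanishes, so [uncut] equals its own [cut] there. This is the conditional
     hypothesis of [cut_ideal], whose conclusion then kills [uncut]. *)
  have eD q : pi q = 0 -> cut (uncut eFT sFT) sFT q = 0 -> uncut eFT sFT q = 0.
    by move=> q0 c0; rewrite uncutE c0 addr0 /eFT /= q0 linear0.
  move=> p0; apply: (eD) => //; apply: cut_ideal; last exact/piI.
    by move=> q /piI q0; rewrite /sFT /= q0 linear0.
  by move=> q /piI; apply: eD.
have [dT dTE] : exists dT : {linear A -> T}, forall p, dT (pi p) = uncut eFT sFT p.
  exact: linear_factor.
(* At (a^2)^2 the e-part vanishes by the definition of Q, leaving only the value of [cut]. *)
have relT a : dT a * sT (mul a a) * sT a = dT (sq mul (sq mul a)).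
  have [p <-] := pi_surj a.
  rewrite -piM4 [RHS]dTE uncutE (cut_sq_sq _ _ k2) /= -dTE /sFT /eFT /= piM4 piM.
  by rewrite eTE (c2Q (sq mul _)) ?linear0 ?add0r // => I _ _; apply.
have half_linear (V : lmodType k) c (x y x' y' : V) :
    2%:R^-1 *: ((c *: x + x') + (c *: y + y')) =
    c *: (2%:R^-1 *: (x + y)) + 2%:R^-1 *: (x' + y').
  by rewrite addrACA -scalerDr [LHS]scalerDr !scalerA mulrC.
have [lT lTE] : exists lT : {linear A -> T},
    forall a, lT a = 2%:R^-1 *: (sT a + dT a).
  by apply: linear_ex => c a b; rewrite (linearP sT) (linearP dT) half_linear.
have [rT rTE] : exists rT : {linear A -> T},
    forall a, rT a = 2%:R^-1 *: (sT a - dT a).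
  apply: linear_ex => c a b; rewrite (linearP sT) (linearP dT) opprD -scalerN.
  exact: half_linear.
have lrTD a : lT a + rT a = sT a.
  by rewrite lTE rTE -scalerDr addrACA subrr addr0 -mulr2n -scaler_nat scalerA
    mulVf ?scale1r.
have lrTB a : lT a - rT a = dT a by rewrite lTE rTE -scalerBr half_diff.
have bimT : is_bimodule mul (regular_lact lT) (regular_ract rT).
  by apply: regular_is_bimodule => // a; rewrite !lrTD !lrTB relT.
pose psi : {lrmorphism ncpoly k (A + A)%type -> T} :=
  nclift (fun s => match s with inl a => lT a | inr a => rT a end).
(* A relation of U holds in the bimodule T; apply it to 1. *)
have rho_psi p : rho p = 0 -> psi p = 0.
  move=> /rhoP /(_ _ _ _ bimT 1); rewrite regular_poly_act mulr1.
  exact.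
have [sec secK] := choice rho_surj.
have psi_eq p q : rho p = rho q -> psi p = psi q.
  move=> pq; apply/eqP; rewrite -subr_eq0 -linearB; apply/eqP/rho_psi.
  by rewrite linearB /= pq subrr.
have [chi chiE] : exists chi : {lrmorphism U -> T},
    forall p, chi (rho p) = psi p.
  have chiP : linear (psi \o sec).
    by move=> c u v /=; rewrite -linearP; apply: psi_eq; rewrite linearP /= !secK.
  have chiM : monoid_morphism (psi \o sec).
    split=> [|u v] /=.
      by rewrite -(rmorph1 psi); apply: psi_eq; rewrite secK rmorph1.
    by rewrite -rmorphM; apply: psi_eq; rewrite rmorphM /= !secK.
  pose chi : {lrmorphism U -> T} := HB.pack (psi \o sec)
    (GRing.isLinear.Build _ _ _ _ _ chiP)
    (GRing.isMonoidMorphism.Build _ _ _ chiM).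
  by exists chi => p; apply: psi_eq; rewrite secK.
have psi_l a : psi (ncvar k (inl a)) = lT a by exact: nclift_var.
have psi_r a : psi (ncvar k (inr a)) = rT a by exact: nclift_var.
have chi_l a : chi (lU a) = lT a by rewrite [LHS]chiE psi_l.
have chi_r a : chi (rU a) = rT a by rewrite [LHS]chiE psi_r.
have chi_s a : chi (sU a) = sT a by rewrite sUE rmorphD /= chi_l chi_r lrTD.
have chi_d a : chi (dU a) = dT a by rewrite dUE rmorphB /= chi_l chi_r lrTB.
(* [chi] matches s and d on both sides, hence [cut], hence e = d - cut. *)
have chi_e a : chi (eU a) = eT a.
  have [p <-] := pi_surj a.
  rewrite eUE eFUE rmorphB /= chi_d dTE.
  rewrite (@cut_morph _ _ _ _ chi _ _ (uncut eFT sFT) sFT) => [|q|q].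
  - by rewrite [X in X - _]uncutE addrK.
  - exact: chi_s.
  - by rewrite /dFU /= chi_d dTE.
pose f : {lrmorphism T -> U} :=
  nclift (fun x : X => match x with inl x => sU (e1 x) | inr x => eU (e2 x) end).
have f_inl x : f (ncvar k (inl x)) = sU (e1 x) by exact: nclift_var.
have f_inr x : f (ncvar k (inr x)) = eU (e2 x) by exact: nclift_var.
have f_s a : f (sT a) = sU a.
  have /eqP := e1c a; rewrite subr_eq0 => /eqP {2}->.
  rewrite sTE /malg_lext !linear_sum; apply: eq_bigr => x _.
  by rewrite !linearZ /= f_inl.
(* The expansion of a in the vectors [e2 x] is exact only modulo Q, which [eU] kills. *)
have f_e a : f (eT a) = eU a.
  have /eU_Q/eqP := e2c a; rewrite linearB subr_eq0 => /eqP ->.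
  rewrite eTE /malg_lext !linear_sum; apply: eq_bigr => x _.
  by rewrite !linearZ /= f_inr.
(* d is determined by s and e, which [f] already matches. *)
have f_d a : f (dT a) = dU a.
  have [p <-] := pi_surj a.
  rewrite dTE (@uncut_morph _ _ _ _ f _ _ dFU sFU) // => q; first exact: f_s.
  by rewrite /eFT /= f_e eUE.
have f_psi : f \o psi =1 rho.
  apply: ncpoly_morphism_ext => [||||s].
  - by move=> c p q; rewrite linearP.
  - by split=> [|p q]; rewrite ?rmorph1 ?rmorphM.
  - exact: linearP.
  - by split=> [|p q]; rewrite ?rmorph1 ?rmorphM.
  case: s => a.
    by rewrite -[LHS]/(f (psi _)) psi_l lTE linearZ linearD /= f_s f_d sUE dUE half_sum.
  by rewrite -[LHS]/(f (psi _)) psi_r rTE linearZ linearB /= f_s f_d sUE dUE half_diff.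
(* [chi \o f] is checked on the variables; [f \o chi] follows from [f_psi], as [rho] is
   surjective. *)
exists X, f, chi => [t|u]; last first.
  by have [p <-] := rho_surj u; rewrite chiE; exact: f_psi.
move: t; apply: (@ncpoly_morphism_ext _ _ _ (chi \o f) id) => [||||x] //.
- by move=> c p q; rewrite linearP.
- by split=> [|p q]; rewrite ?rmorph1 ?rmorphM.
case: x => x; rewrite -[LHS]/(chi (f _)).
  by rewrite f_inl chi_s sTE c1e malg_lextU.
by rewrite f_inr chi_e eTE c2e malg_lextU.
Qed.

Theorem proposition2p3 (k : fieldType) (char0 : [pchar k] =i pred0)
    (Z : choiceType) (A : lmodType k) (mul : {bilinear A -> A -> A})
    (U : algType k) :
  free_M_algebra Z mul -> univ_mult_env mul U -> free_assoc_algebra U.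
Proof.
move=> [pi [piM pi_surj piI]] [rho [rho_surj rhoP]].
rewrite -na_mulE in piM piI.
have k2 : 2%:R != 0 :> k by rewrite ((pcharf0P k).1 char0).
exact: (@free_envelope k Z A mul U pi rho).
Qed.
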